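(* Let $\mathcal{C}$ be a finite, connected category. Then the following statements are equivalent: (i) $\mathcal{C}$ is semisimple. (ii) $\mathcal{C}$ is of finite type. (iii) $\mathcal{C}$ is a groupoid. (iv) For every $\mathcal{C}$-set $\Omega:\mathcal{C}\to\mathrm{set}$, every object $x$ of $\mathcal{C}$ and every element $a\in\Omega(x)$, we have $\mathcal{C}^{\Omega}\cdot a=\mathcal{C}^{\Omega}_{w}\cdot a$; that is, $(\mathcal{C}^{\Omega}\cdot a)(y)=(\mathcal{C}^{\Omega}_{w}\cdot a)(y)$ for every object $y$ of $\mathcal{C}$.
   Context: A category is finite if it has finitely many objects and finitely many morphisms. A $\mathcal{C}$-set is a covariant functor $\Omega:\mathcal{C}\to\mathrm{set}$ to the category of finite sets and functions; morphisms of $\mathcal{C}$-sets are natural transformations. For a morphism $\alpha:x\to y$ and $u\in\Omega(x)$ write $\alpha u:=\Omega(\alpha)(u)$. A $\mathcal{C}$-set is non-empty if $\Omega(x)\neq\emptyset$ for some object $x$; otherwise it is the empty $\mathcal{C}$-set. The disjoint union $\Omega_1\sqcup\Omega_2$ is defined objectwise. A $\mathcal{C}$-subset of $\Omega$ is a subfunctor of $\Omega$. A non-empty $\mathcal{C}$-set $\Omega$ is indecomposable if whenever $\Omega=\Omega_1\sqcup\Omega_2$ then $\Omega_1$ or $\Omega_2$ is empty. A non-empty $\mathcal{C}$-set is simple if its only subfunctors are itself and the empty functor. $\mathcal{C}$ is semisimple if every $\mathcal{C}$-set is isomorphic to a finite disjoint union of simple $\mathcal{C}$-sets. $\mathcal{C}$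 is of finite type if the number of isomorphism classes of indecomposable $\mathcal{C}$-sets is finite. A walk $\alpha:x\rightsquigarrow y$ is a finite sequence $\alpha=\alpha_n\cdots\alpha_1$ of morphisms with objects $x=y_0,y_1,\dots,y_n=y$, where for each $i$ either $\alpha_i:y_{i-1}\to y_i$ (forward) or $\alpha_i:y_i\to y_{i-1}$ (backward). A walk acts on $u\in\Omega(x)$ to give a subset $\alpha u\subseteq\Omega(y)$: starting from $\{u\}$, one successively takes, for $i=1,\dots,n$, the image under $\Omega(\alpha_i)$ if the step is forward, and the preimage under $\Omega(\alpha_i)$ if it is backward. $\mathcal{C}$ is connected if there is a walk between any two of its objects. For $u\in\Omega(x)$, the $\mathcal{C}$-set generated by $u$ is $(\mathcal{C}^{\Omega}\cdot u)(y)=\{\Omega(\alpha)(u):\alpha\in\mathrm{Hom}_{\mathcal{C}}(x,y)\}$, and the $\mathcal{C}$-orbit of $u$ with respect to walks is $(\mathcal{C}^{\Omega}_{w}\cdot u)(y)=\bigcup_{\alpha:x\rightsquigarrow y}\alpha u$, the union being over all walks $\alpha$ from $x$ to $y$. *)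

(* Defs.v *)
From mathcomp Require Import all_boot.
From mathcomp Require Import boolp classical_sets.

Set Implicit Arguments.
Unset Strict Implicit.
Unset Printing Implicit Defensive.

Local Open Scope classical_set_scope.

Record finCategory := FinCategory {
  obj :> finType;
  hom : obj -> obj -> finType;
  hom_id : forall x, hom x x;
  hom_comp : forall x y z, hom y z -> hom x y -> hom x z;
  hom_comp_idl : forall x y (f : hom x y), hom_comp (hom_id y) f = f;
  hom_comp_idr : forall x y (f : hom x y), hom_comp f (hom_id x) = f;
  hom_compA : forall w x y z (h : hom y z) (g : hom x y) (f : hom w x),
    hom_comp h (hom_comp g f) = hom_comp (hom_comp h g) f
}.

Arguments hom {C} x y : rename.
Arguments hom_id {C} x : rename.
Arguments hom_comp {C x y z} g f : rename.

Definition groupoid (C : finCategory) : Prop :=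
  forall (x y : C) (f : hom x y),
    exists g : hom y x, hom_comp g f = hom_id x /\ hom_comp f g = hom_id y.

Record cset (C : finCategory) := CSet {
  cset_ob :> C -> finType;
  cset_map : forall x y, hom x y -> cset_ob x -> cset_ob y;
  cset_map_id : forall x u, cset_map (hom_id x) u = u;
  cset_map_comp : forall x y z (g : hom y z) (f : hom x y) u,
    cset_map (hom_comp g f) u = cset_map g (cset_map f u)
}.

Arguments cset_map {C} Omega {x y} f u : rename.

Record cset_hom (C : finCategory) (Omega1 Omega2 : cset C) := CSetHom {
  cset_hom_fun :> forall x : C, Omega1 x -> Omega2 x;
  cset_hom_natural : forall (x y : C) (f : hom x y) (u : Omega1 x),
    cset_hom_fun (cset_map Omega1 f u) = cset_map Omega2 f (cset_hom_fun u)
}.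

Definition cset_isomorphic (C : finCategory) (Omega1 Omega2 : cset C) : Prop :=
  exists (f : cset_hom Omega1 Omega2) (g : cset_hom Omega2 Omega1),
    forall x : C, cancel (f x) (g x) /\ cancel (g x) (f x).

Definition cset_nonempty (C : finCategory) (Omega : cset C) : Prop :=
  exists x : C, inhabited (Omega x).

Definition cset_empty (C : finCategory) (Omega : cset C) : Prop :=
  ~ cset_nonempty Omega.

Section DisjointUnion.
Variables (C : finCategory) (Omega1 Omega2 : cset C).

Definition cset_sum_ob (x : C) : finType := (Omega1 x + Omega2 x)%type.

Definition cset_sum_map (x y : C) (f : hom x y) (u : cset_sum_ob x) :
    cset_sum_ob y :=
  match u with
  | inl u1 => inl (cset_map Omega1 f u1)
  | inr u2 => inr (cset_map Omega2 f u2)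
  end.

Fact cset_sum_map_id x u : cset_sum_map (hom_id x) u = u.
Proof. by case: u => u /=; rewrite cset_map_id. Qed.

Fact cset_sum_map_comp x y z (g : hom y z) (f : hom x y) u :
  cset_sum_map (hom_comp g f) u = cset_sum_map g (cset_sum_map f u).
Proof. by case: u => u /=; rewrite cset_map_comp. Qed.

Definition cset_sum : cset C := CSet cset_sum_map_id cset_sum_map_comp.

End DisjointUnion.

Section FiniteDisjointUnion.
Variables (C : finCategory) (I : finType) (Omega : I -> cset C).

Definition cset_bigsum_ob (x : C) : finType := {i : I & Omega i x}.

Definition cset_bigsum_map (x y : C) (f : hom x y) (u : cset_bigsum_ob x) :
    cset_bigsum_ob y :=
  Tagged (fun i => Omega i y) (cset_map (Omega (tag u)) f (tagged u)).

Fact cset_bigsum_map_id x u : cset_bigsum_map (hom_id x) u = u.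
Proof. by case: u => i u; rewrite /cset_bigsum_map /= cset_map_id. Qed.

Fact cset_bigsum_map_comp x y z (g : hom y z) (f : hom x y) u :
  cset_bigsum_map (hom_comp g f) u = cset_bigsum_map g (cset_bigsum_map f u).
Proof. by case: u => i u; rewrite /cset_bigsum_map /= cset_map_comp. Qed.

Definition cset_bigsum : cset C :=
  CSet cset_bigsum_map_id cset_bigsum_map_comp.

End FiniteDisjointUnion.

Record csubset (C : finCategory) (Omega : cset C) := CSubset {
  csubset_set :> forall x : C, set (Omega x);
  csubset_stable : forall (x y : C) (f : hom x y) (u : Omega x),
    @csubset_set x u -> @csubset_set y (cset_map Omega f u)
}.

Arguments csubset_set {C Omega} S x _ : rename.

(* Functors are compared up to natural isomorphism: a decomposition
   Omega = Omega1 |_| Omega2 is an isomorphism with an external disjoint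
   union. *)
Definition cset_indecomposable (C : finCategory) (Omega : cset C) : Prop :=
  cset_nonempty Omega /\
  forall Omega1 Omega2 : cset C,
    cset_isomorphic Omega (cset_sum Omega1 Omega2) ->
    cset_empty Omega1 \/ cset_empty Omega2.

Definition cset_simple (C : finCategory) (Omega : cset C) : Prop :=
  cset_nonempty Omega /\
  forall S : csubset Omega,
    (forall x : C, S x = setT) \/ (forall x : C, S x = set0).

(* The empty C-set is the disjoint union of the empty family. *)
Definition semisimple (C : finCategory) : Prop :=
  forall Omega : cset C,
    exists (n : nat) (F : 'I_n -> cset C),
      (forall i, cset_simple (F i)) /\ cset_isomorphic Omega (cset_bigsum F).

(* F lists every isomorphism class of indecomposable C-sets exactly once, so
   n is the number of these classes.  (The type cset C lives in too large a
   universe for the classes to form a classical set with finite_set.) *)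
Definition finite_type (C : finCategory) : Prop :=
  exists (n : nat) (F : 'I_n -> cset C),
    (forall i, cset_indecomposable (F i)) /\
    (forall Omega : cset C, cset_indecomposable Omega ->
      exists! i, cset_isomorphic Omega (F i)).

(* A walk is built from its source: the last constructor is the last step. *)
Inductive walk (C : finCategory) (x : C) : C -> Type :=
  | walk_nil : walk x x
  | walk_forward : forall y z : C, walk x y -> hom y z -> walk x z
  | walk_backward : forall y z : C, walk x y -> hom z y -> walk x z.

Fixpoint walk_act (C : finCategory) (Omega : cset C) (x y : C)
    (w : walk x y) (u : Omega x) : set (Omega y) :=
  match w with
  | walk_nil => [set u]
  | walk_forward _ _ w' f => cset_map Omega f @` walk_act w' u
  | walk_backward _ _ w' f => cset_map Omega f @^-1` walk_act w' u
  end.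

Definition connected_category (C : finCategory) : Prop :=
  forall x y : C, inhabited (walk x y).

Definition cset_generated (C : finCategory) (Omega : cset C) (x : C)
    (u : Omega x) (y : C) : set (Omega y) :=
  [set cset_map Omega f u | f in [set: hom x y]].

Arguments cset_generated {C Omega x} u y _ : rename.

Definition walk_orbit (C : finCategory) (Omega : cset C) (x : C)
    (u : Omega x) (y : C) : set (Omega y) :=
  \bigcup_(w in [set: walk x y]) walk_act w u.

Arguments walk_orbit {C Omega x} u y _ : rename.

(* Main.v *)
Require Import Defs.
From mathcomp Require Import all_boot.
From mathcomp Require Import boolp classical_sets.

(** Each condition is compared with being a groupoid, that is, with every
    morphism having a left inverse. In the representable functor
    [hom x -], a morphism [f : x -> y] has a left inverse exactly when the
    subfunctor generated by [f] contains [hom_id x]; this settles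
    semisimplicity and the walk condition. If [f] has no left inverse, that
    subfunctor is proper, and gluing arbitrarily many copies of [hom x -] along
    it gives indecomposables of unbounded size. Over a groupoid, in turn, every
    indecomposable is generated by one element [u], and is therefore determined
    up to isomorphism by the equivalence relation [h1 u = h2 u] on the
    finitely many morphisms out of an object. *)

Set Implicit Arguments.
Unset Strict Implicit.
Unset Printing Implicit Defensive.

Local Open Scope classical_set_scope.

(** * Left inverses, representable functors and isomorphisms *)

(** The left inverse [g] of [f] has a left inverse [k] of its own, and
    [k = k (g f) = (k g) f = f]. *)
Lemma groupoid_left_inverse (C : finCategory) :
  (forall (x y : C) (f : hom x y), exists g : hom y x, hom_comp g f = hom_id x) ->
  groupoid C.
Proof.
move=> linv x y f; have [g gf] := linv x y f; have [k kg] := linv y x g.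
exists g; split=> //; rewrite -kg; congr hom_comp.
by rewrite -[k]hom_comp_idr -gf hom_compA kg hom_comp_idl.
Qed.

Definition representable (C : finCategory) (x : C) : cset C :=
  @CSet C (hom x) (fun y z g h => hom_comp g h)
    (fun y h => hom_comp_idl h)
    (fun y z w g f h => esym (hom_compA g f h)).

Lemma cset_isomorphic_bij (C : finCategory) (A B : cset C) (phi : cset_hom A B) :
  (forall x, injective (phi x)) -> (forall x v, exists u, phi x u = v) ->
  cset_isomorphic A B.
Proof.
move=> inj /(_ _ _)/cid sur; pose psi x v := sval (sur x v).
have psiK x : cancel (psi x) (phi x) by move=> v; rewrite /psi; case: (sur x v).
have psi_nat (x y : C) (f : hom x y) v :
    psi y (cset_map B f v) = cset_map A f (psi x v).
  by apply: (inj y); rewrite psiK cset_hom_natural psiK.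
exists phi, (CSetHom psi_nat) => x; split=> // u.
by apply: (inj x); rewrite /= psiK.
Qed.

Lemma cset_isomorphic_sym (C : finCategory) (A B : cset C) :
  cset_isomorphic A B -> cset_isomorphic B A.
Proof. by case=> f [g fgK]; exists g, f => x; case: (fgK x). Qed.

Lemma cset_isomorphic_trans (C : finCategory) (A B D : cset C) :
  cset_isomorphic A B -> cset_isomorphic B D -> cset_isomorphic A D.
Proof.
case=> f [g fgK] [f' [g' fgK']].
have nat (x y : C) (h : hom x y) u :
    f' y (f y (cset_map A h u)) = cset_map D h (f' x (f x u)).
  by rewrite !cset_hom_natural.
apply: (@cset_isomorphic_bij _ _ _ (CSetHom nat)) => x /=.
  apply: inj_comp; [exact: can_inj (fgK' x).1 | exact: can_inj (fgK x).1].
by move=> v; exists (g x (g' x v)); rewrite (fgK x).2 (fgK' x).2.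
Qed.

(** * Subfunctors, generation and indecomposability *)

Section Subfunctors.
Variables (C : finCategory) (Omega : cset C).

Section SubCSet.
Variable S : csubset Omega.

Definition sub_cset_ob (x : C) : finType := {u : Omega x | u \in S x}.

Fact sub_cset_map_subproof (x y : C) (f : hom x y) (u : sub_cset_ob x) :
  cset_map Omega f (val u) \in S y.
Proof. by rewrite inE; apply: csubset_stable; rewrite -in_setE (valP u). Qed.

Definition sub_cset_map (x y : C) (f : hom x y) (u : sub_cset_ob x) :
  sub_cset_ob y := Sub (cset_map Omega f (val u)) (sub_cset_map_subproof f u).

Fact sub_cset_map_id x u : sub_cset_map (hom_id x) u = u.
Proof. by apply: val_inj; rewrite /= cset_map_id. Qed.

Fact sub_cset_map_comp x y z (g : hom y z) (f : hom x y) u :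
  sub_cset_map (hom_comp g f) u = sub_cset_map g (sub_cset_map f u).
Proof. by apply: val_inj; rewrite /= cset_map_comp. Qed.

Definition sub_cset : cset C := CSet sub_cset_map_id sub_cset_map_comp.

End SubCSet.

Fact cset_generated_stable x (u : Omega x) (y z : C) (f : hom y z) v :
  cset_generated u y v -> cset_generated u z (cset_map Omega f v).
Proof. by case=> h _ <-; exists (hom_comp f h); rewrite ?cset_map_comp. Qed.

Definition generated x (u : Omega x) : csubset Omega :=
  CSubset (@cset_generated_stable x u).

Lemma generated_self x (u : Omega x) : cset_generated u x u.
Proof. by exists (hom_id x); rewrite ?cset_map_id. Qed.

Lemma cset_generated_trans x y z (u : Omega x) (v : Omega y) (w : Omega z) :
  cset_generated u y v -> cset_generated v z w -> cset_generated u z w.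
Proof. by move=> uv [h _ <-]; apply: cset_generated_stable. Qed.

Lemma cset_generated_sym x y (u : Omega x) (v : Omega y) :
  groupoid C -> cset_generated u y v -> cset_generated v x u.
Proof.
move=> gC [h _ <-]; have [g [gh _]] := gC _ _ h.
by exists g; rewrite // -cset_map_comp gh cset_map_id.
Qed.

Lemma sub_cset_split (S T : csubset Omega) :
  (forall x, T x = ~` S x) ->
  cset_isomorphic Omega (cset_sum (sub_cset S) (sub_cset T)).
Proof.
move=> TE; apply: cset_isomorphic_sym.
pose phi x (u : cset_sum (sub_cset S) (sub_cset T) x) : Omega x :=
  match u with inl v => val v | inr v => val v end.
have phi_nat (x y : C) (f : hom x y) u :
    phi y (cset_map _ f u) = cset_map Omega f (phi x u) by case: u.
apply: (@cset_isomorphic_bij _ _ _ (CSetHom phi_nat)) => x /=.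
  case=> -[u uP] [] [v vP] /= uv; subst v.
  - by congr inl; apply: val_inj.
  - by exfalso; move: uP vP; rewrite !inE TE.
  - by exfalso; move: uP vP; rewrite !inE TE.
  - by congr inr; apply: val_inj.
move=> v; have [Sv|Sv] := pselect (S x v).
  by exists (inl (exist _ v (mem_set Sv))).
have Tv : T x v by rewrite TE.
by exists (inr (exist _ v (mem_set Tv))).
Qed.

(** A decomposition labels each element by its summand. By naturality the label is invariant under
    all morphisms, so if it is constant one summand is empty. *)
Lemma cset_indecomposable_constant :
  cset_nonempty Omega ->
  (forall b : forall x, Omega x -> bool,
     (forall x y (f : hom x y) u, b y (cset_map Omega f u) = b x u) ->
     forall x y u v, b x u = b y v) ->
  cset_indecomposable Omega.
Proof.
move=> Omega0 bconst; split=> // A B [phi [psi phiK]].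
pose b x u := if phi x u is inl _ then true else false.
have bE : forall x y (f : hom x y) u, b y (cset_map Omega f u) = b x u.
  by move=> x y f u; rewrite /b cset_hom_natural; case: (phi x u).
have [[x [u]]|] := pselect (cset_nonempty A); last by left.
right=> -[y [v]].
have := bconst b bE x y (psi x (inl u)) (psi y (inr v)).
by rewrite /b (phiK x).2 (phiK y).2.
Qed.

(** Generation is symmetric over a groupoid, so the complement of a generated subfunctor is again a
    subfunctor and splits off. *)
Lemma cset_indecomposable_generated :
  groupoid C -> cset_indecomposable Omega ->
  exists (x : C) (u : Omega x), forall y, cset_generated u y = setT.
Proof.
move=> gC [[x [u]] indec]; exists x, u => y.
have compl_stable (a b : C) (f : hom a b) v :
    (~` cset_generated u a) v -> (~` cset_generated u b) (cset_map Omega f v).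
  move=> nv uv; apply: nv; apply: cset_generated_trans uv _.
  by apply: cset_generated_sym => //; exists f.
have [E|E] := indec _ _ (@sub_cset_split (generated u)
  (CSubset compl_stable) (fun=> erefl)).
  case: E; exists x; constructor.
  exact: exist _ u (mem_set (generated_self u)).
apply/seteqP; split=> // v _; apply: contrapT => nv; apply: E.
by exists y; constructor; exact: exist _ v (mem_set nv).
Qed.

(** By symmetry any element of a subfunctor generates [u] back, and with it everything. *)
Lemma sub_cset_generated_simple x (u : Omega x) :
  groupoid C -> cset_simple (sub_cset (generated u)).
Proof.
move=> gC; split.
  exists x; constructor; exact: exist _ u (mem_set (generated_self u)).
move=> S; have [[y [v Sv]]|nS] := pselect (exists y v, S y v); last first.
  by right=> y; apply/seteqP; split=> // v Sv; apply: nS; exists y, v.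
left=> z; apply/seteqP; split=> // w _.
have [h _ hv] : cset_generated (val v) z (val w).
  apply: cset_generated_trans (set_mem (valP w)).
  exact/cset_generated_sym/(set_mem (valP v)).
have -> : w = cset_map (sub_cset (generated u)) h v by apply: val_inj.
exact: csubset_stable.
Qed.

End Subfunctors.

(** * Semisimplicity and the walk condition *)

(** Generation is an equivalence relation on the elements of [Omega], and its classes are the simple
    summands. *)
Lemma groupoid_semisimple (C : finCategory) : groupoid C -> semisimple C.
Proof.
move=> gC Omega; pose T : finType := {x : C & Omega x}.
pose tg x (u : Omega x) : T := Tagged (fun x => Omega x) u.
pose e (u v : T) := `[< cset_generated (tagged u) (tag v) (tagged v) >].
have e_refl u : e u u by apply/asboolP; exact: generated_self.
have e_sym u v : e u v -> e v u.
  by move=> /asboolP uv; apply/asboolP; exact: cset_generated_sym.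
have e_trans u v w : e u v -> e v w -> e u w.
  by move=> /asboolP uv /asboolP vw; apply/asboolP;
     exact: cset_generated_trans vw.
(* The result of [choose] depends only on the predicate once the default satisfies it, so equivalent
   elements get the same representative. *)
pose rep u := choose (e u) u.
have e_rep u : e u (rep u) by exact: chooseP.
have rep_eq u v : e u v -> rep u = rep v.
  move=> uv; rewrite /rep (_ : e u = e v); last first.
    apply/funext => w; apply/idP/idP; [exact: e_trans (e_sym _ _ uv)|].
    exact: e_trans.
  by apply: choose_id => //; exact: e_sym.
pose I : {set T} := [set u | rep u == u]%SET.
pose F (i : 'I_#|I|) := sub_cset (generated (tagged (enum_val i))).
exists #|I|, F; split=> [i|]; first exact: sub_cset_generated_simple.
apply: cset_isomorphic_sym.
pose phi x (u : cset_bigsum F x) : Omega x := val (tagged u).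
have phi_nat (x y : C) (f : hom x y) u :
  phi y (cset_map _ f u) = cset_map Omega f (phi x u) by [].
have e_enum x (i : 'I_#|I|) (u : F i x) : e (enum_val i) (tg _ (val u)).
  by apply/asboolP; exact: (set_mem (valP u)).
apply: (@cset_isomorphic_bij _ _ _ (CSetHom phi_nat)) => x /=.
  case=> i u [j v]; rewrite /phi /= => uv.
  have ij : i = j.
    apply: enum_val_inj.
    have := enum_valP i; have := enum_valP j.
    rewrite !inE => /eqP <- /eqP <-; apply: rep_eq.
    apply: e_trans (e_enum _ _ u) _; apply: e_sym.
    by rewrite -[val u]/(sval u) uv; exact: e_enum.
  by subst j; congr existT; exact: val_inj.
move=> v; pose r := rep (tg _ v).
have rI : r \in I by rewrite inE; apply/eqP/esym/rep_eq/e_rep.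
have vP : v \in generated (tagged (enum_val (enum_rank_in rI r))) x.
  rewrite inE enum_rankK_in //.
  by have /asboolP := e_sym _ _ (e_rep (tg _ v)).
by exists (Tagged (fun i => F i x) (exist _ v vP : F (enum_rank_in rI r) x)).
Qed.

(** The identity of [x] lands in one simple summand. Its translate by [f] generates that summand, so
    some [g] moves it back. *)
Lemma semisimple_groupoid (C : finCategory) : semisimple C -> groupoid C.
Proof.
move=> ss; apply: groupoid_left_inverse => x y f.
have [n [F [Fsimple [phi [psi phiK]]]]] := ss (representable x).
case E: (phi x (hom_id x)) => [i u].
have [[]] := Fsimple i; have [_ /(_ (generated (cset_map _ f u)))] := Fsimple i.
move=> [S|S] _ _; last first.
  have := generated_self (cset_map (F i) f u).
  by rewrite -[cset_generated _ _]/(generated (cset_map _ f u) y) S.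
have : generated (cset_map (F i) f u) x u by rewrite S.
case=> g _ gfu; exists g; apply: (can_inj (phiK x).1).
rewrite -[hom_comp g f]hom_comp_idr E.
have -> := cset_hom_natural phi (hom_comp g f) (hom_id x).
by rewrite E /= /cset_bigsum_map /= cset_map_comp gfu.
Qed.

(** A backward step goes from the image of [v] under [f] to [v], which that image generates by
    symmetry. *)
Lemma groupoid_walk_orbit (C : finCategory) (Omega : cset C) (x : C)
    (a : Omega x) (y : C) :
  groupoid C -> cset_generated a y = walk_orbit a y.
Proof.
move=> gC; apply/seteqP; split=> [v [f _ <-]|v [w _]].
  by exists (walk_forward (walk_nil x) f) => //=; exists a.
elim: w v => {y} [|y z w IH f|y z w IH f] v /=.
- by move=> ->; exact: generated_self.
- by case=> u /IH au <-; exact: cset_generated_stable.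
- move=> /IH afv; apply: cset_generated_trans afv _.
  by apply: cset_generated_sym => //; exists f.
Qed.

Lemma walk_orbit_groupoid (C : finCategory) :
  (forall (Omega : cset C) (x : C) (a : Omega x) (y : C),
     cset_generated a y = walk_orbit a y) ->
  groupoid C.
Proof.
move=> H; apply: groupoid_left_inverse => x y f.
have : walk_orbit (f : representable x y) x (hom_id x).
  (* One backward step along [f] leads from [f] to the identity. *)
  by exists (walk_backward (walk_nil y) f) => //=; rewrite hom_comp_idr.
by rewrite -H => -[g _ gf]; exists g.
Qed.

(** * Groupoids are of finite type *)

Section FiniteType.
Variable C : finCategory.

(** The code is a relation, since each choice of a generator may give a different one. *)
Lemma finite_type_code (K : finType) (code : cset C -> K -> Prop) :
  (forall A, cset_indecomposable A -> exists k, code A k) ->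
  (forall A B k, code A k -> code B k -> cset_isomorphic A B) ->
  finite_type C.
Proof.
move=> codeP code_iso.
suff [n [F [Findec Finj FP]]] : exists n (F : 'I_n -> cset C),
    [/\ forall i, cset_indecomposable (F i),
        forall i j, cset_isomorphic (F i) (F j) -> i = j &
        forall A k, cset_indecomposable A -> code A k -> k \in enum K ->
          exists i, cset_isomorphic A (F i)].
  exists n, F; split=> // A Aindec; have [k Ak] := codeP A Aindec.
  have [i Ai] := FP A k Aindec Ak (mem_enum K k).
  exists i; split=> // j Aj; apply: Finj.
  exact: cset_isomorphic_trans (cset_isomorphic_sym Ai) Aj.
(* Each code contributes at most one class, which is added only if it is not yet listed. *)
elim: (enum K) => [|k s [n [F [Findec Finj FP]]]].
  have F0 : 'I_0 -> cset C by case.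
  by exists 0, F0; split=> // -[].
have [[A [Aindec Ak AF]]|noA] := pselect (exists A, [/\ cset_indecomposable A,
    code A k & forall i, ~ cset_isomorphic A (F i)]).
  pose G (i : 'I_n.+1) := if unlift ord0 i is Some j then F j else A.
  exists n.+1, G; rewrite /G; split.
  - by move=> i; case: unliftP.
  - move=> i j; case: unliftP => [i'|] ->; case: unliftP => [j'|] -> //.
    + by move/Finj->.
    + by move/cset_isomorphic_sym/AF.
    + by move/AF.
  - move=> B l Bindec Bl; rewrite inE => /orP[/eqP lk|ls].
      exists ord0; rewrite unlift_none.
      by apply: code_iso Ak; rewrite -lk.
    have [i Bi] := FP B l Bindec Bl ls.
    by exists (lift ord0 i); rewrite liftK.
exists n, F; split=> // B l Bindec Bl; rewrite inE => /orP[/eqP lk|];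
  last exact: FP.
apply: contrapT => nB; apply: noA; exists B; split=> //; first by rewrite -lk.
by move=> i Bi; apply: nB; exists i.
Qed.

(** The isomorphism sends [h u] to [h v]. The last hypothesis makes it both well defined and
    injective. *)
Lemma cset_generated_isomorphic (A B : cset C) (x : C) (u : A x) (v : B x) :
  (forall y, cset_generated u y = setT) ->
  (forall y, cset_generated v y = setT) ->
  (forall y (h1 h2 : hom x y),
     (cset_map A h1 u == cset_map A h2 u) =
     (cset_map B h1 v == cset_map B h2 v)) ->
  cset_isomorphic A B.
Proof.
move=> genu genv uvE.
have sur y w : exists h : hom x y, cset_map A h u = w.
  have [h _ <-] : cset_generated u y w by rewrite genu.
  by exists h.
pose lft y w := sval (cid (sur y w)).
have lftK y w : cset_map A (lft y w) u = w by rewrite /lft; case: cid.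
pose phi y w := cset_map B (lft y w) v.
have phiE y (h : hom x y) : phi y (cset_map A h u) = cset_map B h v.
  by apply/eqP; rewrite -uvE lftK.
have phi_nat (y z : C) (f : hom y z) w :
    phi z (cset_map A f w) = cset_map B f (phi y w).
  by rewrite -{1}(lftK y w) -cset_map_comp phiE cset_map_comp.
apply: (@cset_isomorphic_bij _ _ _ (CSetHom phi_nat)) => y /=.
  by move=> w w' /eqP; rewrite /phi -uvE !lftK => /eqP.
move=> w; have [h _ <-] : cset_generated v y w by rewrite genv.
by exists (cset_map A h u); rewrite phiE.
Qed.

Lemma groupoid_finite_type : groupoid C -> finite_type C.
Proof.
move=> gC.
(* A code is the object carrying the generator, with the set of parallel pairs that agree on it. *)
pose K : finType := {x : C & {set {y : C & (hom x y * hom x y)%type}}}.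
pose code (A : cset C) (k : K) := exists u : A (tag k),
  (forall y, cset_generated u y = setT) /\
  forall y (h1 h2 : hom (tag k) y),
    (cset_map A h1 u == cset_map A h2 u) =
    (Tagged (fun y => (hom (tag k) y * hom (tag k) y)%type) (h1, h2)
       \in tagged k).
apply: (@finite_type_code K code) => [A Aindec|A B k [u [genu uE]] [v [genv vE]]].
  have [x [u genu]] := cset_indecomposable_generated gC Aindec.
  exists (Tagged (fun x => {set {y : C & (hom x y * hom x y)%type}})
    [set p : {y : C & (hom x y * hom x y)%type} |
       cset_map A (tagged p).1 u == cset_map A (tagged p).2 u]%SET).
  by exists u; split=> // y h1 h2; rewrite inE.
by apply: (cset_generated_isomorphic genu genv) => y h1 h2; rewrite uE vE.
Qed.

End FiniteType.

(** * Indecomposables of unbounded size *)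

(* [m.+1] copies of [Omega] glued along [S]: an element of [S] is kept only in
   the copy [ord0]. *)
Section Amalgam.
Variables (C : finCategory) (Omega : cset C) (S : csubset Omega) (m : nat).

Definition amalgam_ob (x : C) : finType :=
  {p : Omega x * 'I_m.+1 | (p.1 \in S x) ==> (p.2 == ord0)}.

Fact amalgam_in_subproof x (u : Omega x) (i : 'I_m.+1) :
  let p := (u, if u \in S x then ord0 else i) in
  (p.1 \in S x) ==> (p.2 == ord0).
Proof. by rewrite /=; case: (u \in S x). Qed.

(** The inclusion of the [i]-th copy. Normal forms take the place of a quotient. *)
Definition amalgam_in x (u : Omega x) i : amalgam_ob x :=
  Sub (u, if u \in S x then ord0 else i) (amalgam_in_subproof u i).

Definition amalgam_map (x y : C) (f : hom x y) (p : amalgam_ob x) :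
  amalgam_ob y := amalgam_in (cset_map Omega f (val p).1) (val p).2.

Lemma amalgam_inK x (p : amalgam_ob x) : amalgam_in (val p).1 (val p).2 = p.
Proof.
case: p => -[u i] /= ui; apply: val_inj; congr pair.
by move: ui => /=; case: ifP => //= _ /eqP.
Qed.

(** Normalising the index before applying [f] is harmless because [S] is stable. *)
Lemma amalgam_map_in x y (f : hom x y) (u : Omega x) i :
  amalgam_map f (amalgam_in u i) = amalgam_in (cset_map Omega f u) i.
Proof.
apply: val_inj => /=; congr pair.
case: ifP => // fuS; case: ifP => // /set_mem uS.
by rewrite (mem_set (csubset_stable f uS)) in fuS.
Qed.

Fact amalgam_map_id x u : amalgam_map (hom_id x) u = u.
Proof. by rewrite /amalgam_map cset_map_id amalgam_inK. Qed.

Fact amalgam_map_comp x y z (g : hom y z) (f : hom x y) u :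
  amalgam_map (hom_comp g f) u = amalgam_map g (amalgam_map f u).
Proof. by rewrite [amalgam_map f u]/amalgam_map amalgam_map_in -cset_map_comp. Qed.

Definition amalgam : cset C := CSet amalgam_map_id amalgam_map_comp.

(** Within a copy an invariant label is constant, since [u] generates the copy; all copies share
    [v]. *)
Lemma amalgam_indecomposable x (u : Omega x) y (v : Omega y) :
  (forall z, cset_generated u z = setT) -> S y v -> cset_indecomposable amalgam.
Proof.
move=> genu Sv; apply: cset_indecomposable_constant.
  by exists x; constructor; exact: amalgam_in u ord0.
move=> b bE.
suff bv z p : b z p = b y (amalgam_in v ord0) by move=> z w p q; rewrite !bv.
have reach w (q : Omega w) i : b w (amalgam_in q i) = b x (amalgam_in u i).
  have [h _ <-] : cset_generated u w q by rewrite genu.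
  by rewrite -amalgam_map_in bE.
have -> : amalgam_in v ord0 = amalgam_in v (val p).2.
  by apply: val_inj; rewrite /= mem_set.
by rewrite -[in LHS](amalgam_inK p) !reach.
Qed.

(** The [m.+1] copies of an element outside [S] stay distinct. *)
Lemma card_amalgam x (u : Omega x) : ~ S x u -> m < #|amalgam x|.
Proof.
move=> nSu; rewrite -[m.+1]card_ord; apply: (@leq_card _ _ (amalgam_in u)).
by move=> i j /(congr1 val) []; rewrite memNset.
Qed.

End Amalgam.

Lemma finite_type_groupoid (C : finCategory) : finite_type C -> groupoid C.
Proof.
move=> [n [F [_ FP]]]; apply: groupoid_left_inverse => x y f.
apply: contrapT => nf.
pose S := generated (f : representable x y).
(* No listed indecomposable has more than [m] elements at [x], whereas the amalgam has. *)
pose m := \sum_i #|F i x|.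
have gen_id z : cset_generated (hom_id x : representable x x) z = setT.
  by apply/seteqP; split=> // h _; exists h; rewrite //= hom_comp_idr.
have [i [[phi [psi phiK]] _]] :=
  FP _ (@amalgam_indecomposable _ _ S m _ _ _ _ gen_id (generated_self _)).
have nSid : ~ S x (hom_id x) by case=> g _ gf; apply: nf; exists g.
have := card_amalgam m nSid; rewrite ltnNge => /negP; apply.
apply: leq_trans (leq_card _ (can_inj (phiK x).1)) _.
by rewrite /m (bigD1 i) //= leq_addr.
Qed.

Theorem theorem1 (C : finCategory) (HC : connected_category C) :
  [<-> semisimple C;
       finite_type C;
       groupoid C;
       forall (Omega : cset C) (x : C) (a : Omega x) (y : C),
         cset_generated a y = walk_orbit a y].
Proof.
tfae.
- by move/semisimple_groupoid/groupoid_finite_type.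
- exact: finite_type_groupoid.
- by move=> gC Omega x a y; exact: groupoid_walk_orbit.
- by move/walk_orbit_groupoid/groupoid_semisimple.
Qed.
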